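(* Let $\{x^{ag}_k\}$ be the iterates generated by the UPFAG algorithm (described in the context) applied to the problem $\Psi^*=\min_{x\in X}\{\Psi(x)=f(x)+\mathcal{X}(x)\}$, where $f$ satisfies $\|f'(y)-f'(x)\|\le H\|y-x\|^\nu$ on $X$ for some $H>0$ and $\nu\in[0,1]$. Let $\Gamma_1:=1$ and $\Gamma_k:=(1-\alpha_k)\Gamma_{k-1}$ for $k\ge2$. (a) The line search procedures in Step 1 and Step 2 of the algorithm finish in a finite number of inner iterations, i.e., at every iteration $k$ there exist finite integers $\tau_{1,k}\ge0$ and $\tau_{2,k}\ge0$ for which the respective line search conditions hold. (b) Suppose that $\Psi$ is bounded below over $X$, i.e., $\Psi^*$ is finite. Then, for any $N\ge1$, we have $$\min_{k=1,\ldots,N}\|\hat g_{X,k}\|^2\le\frac{2\left[\Psi(x_0)-\Psi^*+\sum_{k=\lfloor N/2\rfloor+1}^N k^{-1}\right]}{\gamma\sum_{k=\lfloor N/2\rfloor+1}^N\beta_k},$$ where $\hat g_{X,k}=(x^{ag}_{k-1}-\bar x^{ag}_k)/\beta_k$. (c) Suppose that $f$ is convex and an optimal solution $x^*$ exists for the problem $\min_{x\in X}\Psi(x)$. Then for any $N\ge1$, we have $$\Psi(x^{ag}_N)-\Psi(x^* )\le\frac{\Gamma_N\|x_0-x^*\|^2}{2\lambda_1}+\delta.$$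
   Context: Setting: $X\subseteq\mathbb{R}^n$ is a closed convex set, $f:X\to\mathbb{R}$ is possibly nonconvex with gradient $f'$ (in the case $\nu=0$, nonsmooth convex $f$ with $f'(x)$ a subgradient is also allowed), $\mathcal{X}$ is a (possibly nondifferentiable) convex real-valued function on $X$, $\Psi:=f+\mathcal{X}$, and $\Psi^*:=\min_{x\in X}\Psi(x)$ denotes the optimal value (infimum). $\|\cdot\|$ is the Euclidean norm and $\|x\|_G=\sqrt{\langle Gx,x\rangle}$ for positive definite $G$. There are $H>0$, $\nu\in[0,1]$ with $\|f'(y)-f'(x)\|\le H\|y-x\|^\nu$ for all $x,y\in X$; consequently $|f(y)-f(x)-\langle f'(x),y-x\rangle|\le\frac{H}{1+\nu}\|y-x\|^{1+\nu}$ for all $x,y\in X$. UPFAG algorithm. Input: $x_0\in X$, line search parameters $0<\gamma<\sigma<1$, $\gamma_1,\gamma_2\in(0,1)$, and accuracy parameter $\delta>0$. Set $x^{ag}_0=x_0$, $\Lambda_0=0$. For $k=1,2,\ldots$: 1. Choose an initial stepsize $\hat\lambda_k>0$ and find the smallest integer $\tau_{1,k}\ge0$ such that with $\eta_k=\hat\lambda_k\gamma_1^{\tau_{1,k}}$, $\lambda_k=\frac12\left(\eta_k+\sqrt{\eta_k^2+4\eta_k\Lambda_{k-1}}\right)$, $\Lambda_k=\sum_{i=1}^k\lambda_i$, $\alpha_k=\lambda_k/\Lambda_k$, the points $x^{md}_k=(1-\alpha_k)x^{ag}_{k-1}+\alpha_kx_{k-1}$, $x_k=\arg\min_{u\in X}\{\langle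 f'(x^{md}_k),u\rangle+\frac1{2\lambda_k}\|u-x_{k-1}\|^2+\mathcal{X}(u)\}$, $\tilde x^{ag}_k=(1-\alpha_k)x^{ag}_{k-1}+\alpha_kx_k$ satisfy the line search condition $f(\tilde x^{ag}_k)\le f(x^{md}_k)+\alpha_k\langle f'(x^{md}_k),x_k-x_{k-1}\rangle+\frac{\alpha_k}{2\lambda_k}\|x_k-x_{k-1}\|^2+\delta\alpha_k$. 2. Choose an initial stepsize $\hat\beta_k>0$ and a symmetric matrix $G_k\succeq\sigma I$, and find the smallest integer $\tau_{2,k}\ge0$ such that with $\beta_k=\hat\beta_k\gamma_2^{\tau_{2,k}}$ and $\bar x^{ag}_k=\arg\min_{u\in X}\{\langle f'(x^{ag}_{k-1}),u\rangle+\frac1{2\beta_k}\|u-x^{ag}_{k-1}\|_{G_k}^2+\mathcal{X}(u)\}$, the line search condition $\Psi(\bar x^{ag}_k)\le\Psi(x^{ag}_{k-1})-\frac{\gamma}{2\beta_k}\|\bar x^{ag}_k-x^{ag}_{k-1}\|^2+\frac1k$ holds. 3. Choose $x^{ag}_k\in\{x^{ag}_{k-1},\bar x^{ag}_k,\tilde x^{ag}_k\}$ such that $\Psi(x^{ag}_k)=\min\{\Psi(x^{ag}_{k-1}),\Psi(\bar x^{ag}_k),\Psi(\tilde x^{ag}_k)\}$. The minimizers in the subproblems are assumed to exist. *)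

(* Defs.v *)
From mathcomp Require Export all_boot all_order all_algebra.
From mathcomp Require Export all_classical all_reals all_analysis.
Export Order.TTheory GRing.Theory Num.Theory.
Export numFieldNormedType.Exports.

Set Implicit Arguments.
Unset Strict Implicit.
Unset Printing Implicit Defensive.

Local Open Scope classical_set_scope.
Local Open Scope ring_scope.

Section Euclidean.
Context {R : realType} {n : nat}.
Implicit Types (X : set 'cV[R]_n) (u v x g : 'cV[R]_n) (G : 'M[R]_n).

Definition dot u v : R := \sum_i u i 0 * v i 0.

(* The library norm on matrices is the sup norm. *)
Definition enorm u : R := Num.sqrt (dot u u).

Definition gnorm G u : R := Num.sqrt (dot (G *m u) u).

Definition sym_loewner_ge G (s : R) : Prop :=
  G^T = G /\ forall u, 0 <= dot ((G - s%:M) *m u) u.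

(* Differentiability relative to X: x may be a boundary point of X, and only
   the values of F on X matter. *)
Definition is_gradient_within X (F : 'cV[R]_n -> R) x g : Prop :=
  forall e : R, 0 < e -> \forall y \near within X (nbhs x),
    `|F y - F x - dot g (y - x)| <= e * enorm (y - x).

Definition is_subgradient X (F : 'cV[R]_n -> R) x g : Prop :=
  forall y, X y -> F x + dot g (y - x) <= F y.

Definition is_argmin X (F : 'cV[R]_n -> R) u : Prop :=
  X u /\ forall v, X v -> F u <= F v.

End Euclidean.

Record upfag_input (R : realType) (n : nat) := UpfagInput {
  dom : set 'cV[R]_n;
  fobj : 'cV[R]_n -> R;          (* f *)
  fgrad : 'cV[R]_n -> 'cV[R]_n;  (* f' *)
  chi : 'cV[R]_n -> R;
  xinit : 'cV[R]_n;
  gamma : R;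
  sigma : R;
  gamma1 : R;
  gamma2 : R;
  delta : R }.

(* All quantities of iteration k are stored at index k >= 1; index 0 of xs and
   xag holds the starting point.  trial1 k t and trial2 k t are the solutions
   of the two subproblems of iteration k at the t-th backtracking stepsize. *)
Record upfag_trace (R : realType) (n : nat) := UpfagTrace {
  lamhat : nat -> R;
  tau1 : nat -> nat;
  trial1 : nat -> nat -> 'cV[R]_n;
  lam : nat -> R;
  xs : nat -> 'cV[R]_n;
  betahat : nat -> R;
  Gmat : nat -> 'M[R]_n;
  tau2 : nat -> nat;
  trial2 : nat -> nat -> 'cV[R]_n;
  xag : nat -> 'cV[R]_n }.

Definition is_first (A : nat -> Prop) (t : nat) : Prop :=
  A t /\ forall s, (s < t)%N -> ~ A s.

Section UPFAG.
Context {R : realType} {n : nat}.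
Variables (P : upfag_input R n) (T : upfag_trace R n).
Implicit Types (k t : nat) (u : 'cV[R]_n).

Definition Psi u : R := fobj P u + chi P u.

Definition Lam k : R := \sum_(1 <= i < k.+1) lam T i.

Definition eta_trial k t : R := lamhat T k * gamma1 P ^+ t.

Definition lam_trial k t : R :=
  let eta := eta_trial k t in
  2^-1 * (eta + Num.sqrt (eta ^+ 2 + 4 * eta * Lam k.-1)).

Definition alpha_trial k t : R :=
  lam_trial k t / (Lam k.-1 + lam_trial k t).

Definition xmd_trial k t : 'cV[R]_n :=
  (1 - alpha_trial k t) *: xag T k.-1 + alpha_trial k t *: xs T k.-1.

Definition subproblem1 k t u : R :=
  dot (fgrad P (xmd_trial k t)) u
  + (2 * lam_trial k t)^-1 * enorm (u - xs T k.-1) ^+ 2 + chi P u.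

Definition xtilde_trial k t : 'cV[R]_n :=
  (1 - alpha_trial k t) *: xag T k.-1 + alpha_trial k t *: trial1 T k t.

Definition linesearch1 k t : Prop :=
  let a := alpha_trial k t in
  let d := trial1 T k t - xs T k.-1 in
  fobj P (xtilde_trial k t) <=
    fobj P (xmd_trial k t) + a * dot (fgrad P (xmd_trial k t)) d
    + a / (2 * lam_trial k t) * enorm d ^+ 2 + delta P * a.

(* A trial is only computed when all the earlier ones were rejected, so these
   are the only subproblems whose minimizer has to exist. *)
Definition trials1 k : Prop :=
  0 < lamhat T k /\
  forall t, (forall s, (s < t)%N -> ~ linesearch1 k s) ->
    is_argmin (dom P) (subproblem1 k t) (trial1 T k t).

Definition beta_trial k t : R := betahat T k * gamma2 P ^+ t.

Definition subproblem2 k t u : R :=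
  dot (fgrad P (xag T k.-1)) u
  + (2 * beta_trial k t)^-1 * gnorm (Gmat T k) (u - xag T k.-1) ^+ 2
  + chi P u.

Definition linesearch2 k t : Prop :=
  Psi (trial2 T k t) <=
    Psi (xag T k.-1)
    - gamma P / (2 * beta_trial k t) * enorm (trial2 T k t - xag T k.-1) ^+ 2
    + k%:R^-1.

Definition trials2 k : Prop :=
  [/\ 0 < betahat T k,
      sym_loewner_ge (Gmat T k) (sigma P) &
      forall t, (forall s, (s < t)%N -> ~ linesearch2 k s) ->
        is_argmin (dom P) (subproblem2 k t) (trial2 T k t)].

Definition beta k : R := beta_trial k (tau2 T k).
Definition xtilde k : 'cV[R]_n := xtilde_trial k (tau1 T k).
Definition xbar k : 'cV[R]_n := trial2 T k (tau2 T k).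

Definition upfag_step1 k : Prop :=
  [/\ trials1 k, is_first (linesearch1 k) (tau1 T k),
      lam T k = lam_trial k (tau1 T k) & xs T k = trial1 T k (tau1 T k)].

Definition upfag_step2 k : Prop :=
  trials2 k /\ is_first (linesearch2 k) (tau2 T k).

Definition upfag_step3 k : Prop :=
  [\/ xag T k = xag T k.-1, xag T k = xbar k | xag T k = xtilde k] /\
  Psi (xag T k) =
    Num.min (Psi (xag T k.-1)) (Num.min (Psi (xbar k)) (Psi (xtilde k))).

(* The first N iterations of T form an execution of the algorithm. *)
Definition upfag_run (N : nat) : Prop :=
  [/\ xs T 0 = xinit P, xag T 0 = xinit P &
      forall k, (1 <= k <= N)%N ->
        [/\ upfag_step1 k, upfag_step2 k & upfag_step3 k]].

Definition alpha k : R := lam T k / Lam k.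

Definition ghat k : 'cV[R]_n := (beta k)^-1 *: (xag T k.-1 - xbar k).

(* Gam 0 is a dummy value; Gam 1 = 1. *)
Fixpoint Gam k : R :=
  match k with
  | 0 | 1 => 1
  | k'.+1 => (1 - alpha k) * Gam k'
  end.

End UPFAG.

(* Main.v *)
(** Since [d `^ nu <= 1 + d], the Hoelder condition gives
    [f y - f x - <f' x, y - x> <= H (1 + d) d] with [d = |y - x|], and the right
    side is at most [C d^2 + eps] for any prescribed [eps > 0].  Both line
    searches contain a slack ([delta alpha_k], resp. [1/k]) that absorbs [eps],
    while [C d^2] is absorbed by the proximal term once the stepsize is small:
    this is (a).  For (b), the second line search telescopes because
    [Psi (xag k)] is nonincreasing.  For (c), the potential
    [Lam k (Psi (xag k) - Psi u) + |u - x k|^2 / 2] grows by at most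
    [delta lam k] in iteration [k], and [Gam k = lam 1 / Lam k]. *)
Require Import Defs.
From mathcomp Require Import ring lra.
Set Implicit Arguments.
Unset Strict Implicit.
Unset Printing Implicit Defensive.
Local Open Scope classical_set_scope.
Local Open Scope ring_scope.

(** * Euclidean inner product and norm *)

Section Dot.
Context {R : realType} {n : nat}.
Implicit Types u v w : 'cV[R]_n.

Lemma dotC u v : dot u v = dot v u.
Proof. by apply: eq_bigr => i _; rewrite mulrC. Qed.

Lemma dotDl u v w : dot (u + v) w = dot u w + dot v w.
Proof. by rewrite -big_split; apply: eq_bigr => i _; rewrite mxE mulrDl. Qed.

Lemma dotZl a u v : dot (a *: u) v = a * dot u v.
Proof. by rewrite mulr_sumr; apply: eq_bigr => i _; rewrite mxE mulrA. Qed.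

Lemma dotNl u v : dot (- u) v = - dot u v.
Proof. by rewrite -scaleN1r dotZl mulN1r. Qed.

Lemma dotDr u v w : dot w (u + v) = dot w u + dot w v.
Proof. by rewrite ![dot w _]dotC dotDl. Qed.

Lemma dotZr a u v : dot u (a *: v) = a * dot u v.
Proof. by rewrite ![dot u _]dotC dotZl. Qed.

Lemma dotNr u v : dot u (- v) = - dot u v.
Proof. by rewrite ![dot u _]dotC dotNl. Qed.

Definition dotE := (dotDl, dotDr, dotNl, dotNr, dotZl, dotZr).

Lemma dot_ge0 u : 0 <= dot u u.
Proof. by apply: sumr_ge0 => i _; rewrite -expr2 sqr_ge0. Qed.

Lemma dot_eq0 u : dot u u = 0 -> u = 0.
Proof.
move=> /eqP; rewrite psumr_eq0 => [/allP u0|i _]; last by rewrite -expr2 sqr_ge0.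
apply/colP => i; apply/eqP; rewrite mxE -sqrf_eq0.
by have := u0 i (mem_index_enum i); rewrite expr2.
Qed.

Lemma enorm_ge0 u : 0 <= enorm u.
Proof. exact: sqrtr_ge0. Qed.

Lemma enorm_sqr u : enorm u ^+ 2 = dot u u.
Proof. exact/sqr_sqrtr/dot_ge0. Qed.

Lemma enormZ a u : enorm (a *: u) = `|a| * enorm u.
Proof.
by rewrite /enorm dotZl dotZr mulrA -expr2 sqrtrM ?sqr_ge0// sqrtr_sqr.
Qed.

Lemma enormN u : enorm (- u) = enorm u.
Proof. by rewrite /enorm dotNl dotNr opprK. Qed.

Lemma enormB u v : enorm (u - v) = enorm (v - u).
Proof. by rewrite -enormN opprB. Qed.

(** Expand the nonnegative square of [dot v v *: u - dot u v *: v]: it equals [dot v v] times the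
    gap [dot u u * dot v v - dot u v ^+ 2]. *)
Lemma CauchySchwarz_dot u v : dot u v <= enorm u * enorm v.
Proof.
have [v0|v_neq0] := eqVneq (dot v v) 0.
  by rewrite (dot_eq0 v0) -(scale0r 0) dotZr mul0r mulr_ge0// enorm_ge0.
have v_gt0 : 0 < dot v v by rewrite lt_neqAle eq_sym v_neq0 dot_ge0.
rewrite -sqrtrM ?dot_ge0//; apply: le_trans (ler_norm _) _.
rewrite -sqrtr_sqr ler_wsqrtr//.
have := dot_ge0 (dot v v *: u - dot u v *: v).
rewrite !dotE [dot v u]dotC => h.
rewrite -subr_ge0 -(pmulr_rge0 _ v_gt0); apply: le_trans h _.
by rewrite le_eqVlt; apply/orP; left; apply/eqP; ring.
Qed.

End Dot.

(** * Convex combinations with the weight [s] on the second point *)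

Section Convexity.
Context {R : realType} {E : lmodType R}.

Lemma convex_setP (X : set E) : convex_set X ->
  forall x y (s : R), X x -> X y -> 0 <= s <= 1 -> X ((1 - s) *: x + s *: y).
Proof.
move=> cX x y s Xx Xy /andP[s0 s1].
have := cX y x (Itv01 s0 s1) (mem_set Xy) (mem_set Xx).
by rewrite inE addrC.
Qed.

Lemma convex_functionP (X : set E) (F : E -> R) : convex_function X F ->
  forall x y (s : R), X x -> X y -> 0 <= s <= 1 ->
    F ((1 - s) *: x + s *: y) <= (1 - s) * F x + s * F y.
Proof.
move=> cF x y s Xx Xy /andP[s0 s1].
have := cF (Itv01 s0 s1) y x (mem_set Xy) (mem_set Xx).
by rewrite addrC [leRHS]addrC.
Qed.

End Convexity.

Lemma convex_combE (R : pzRingType) (E : lmodType R) (s : R) (x y : E) :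
  (1 - s) *: x + s *: y = x + s *: (y - x).
Proof. by rewrite scalerBr scalerBl scale1r -addrA (addrC (- _)). Qed.

(** * Least witnesses and elementary real inequalities *)

Lemma exists_is_first (A : nat -> Prop) :
  (exists t, A t) -> exists t, is_first A t.
Proof.
move=> [t0 At0]; have /ex_minnP[t /asboolP At tmin] : exists t, `[< A t >].
  by exists t0; apply/asboolP.
exists t; split=> // s st As; have /tmin : `[< A s >] by apply/asboolP.
by rewrite leqNgt st.
Qed.

Lemma exists_geometric_le (R : realType) (a q c : R) :
  0 < q < 1 -> 0 < c -> exists t : nat, a * q ^+ t <= c.
Proof.
move=> /andP[q0 q1] c0.
have /cvgrPdist_le/(_ _ c0)[t _ ht] : a * q ^+ t @[t --> \oo] --> (0 : R).
  by apply: cvg_geometric; rewrite ger0_norm// ltW.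
exists t; have := ht t (leqnn t); rewrite /= sub0r normrN.
exact/le_trans/ler_norm.
Qed.

(** Completing the square: [H * d] is at most [H ^+ 2 / (4 * eps) * d ^+ 2 + eps], with defect
    [(2 * eps - H * d) ^+ 2 / (4 * eps)]. *)
Lemma linear_le_quadratic (R : realType) (H eps : R) : 0 < H -> 0 < eps ->
  exists2 C, 0 < C & forall d, 0 <= d -> H * (1 + d) * d <= C * d ^+ 2 + eps.
Proof.
move=> H0 e0; exists (H + H ^+ 2 / (4 * eps)).
  by rewrite addr_gt0// divr_gt0 ?exprn_gt0// mulr_gt0.
move=> d d0.
have -> : (H + H ^+ 2 / (4 * eps)) * d ^+ 2 + eps =
  H * (1 + d) * d + (2 * eps - H * d) ^+ 2 / (4 * eps).
  by field; apply: lt0r_neq0.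
by rewrite lerDl divr_ge0 ?sqr_ge0// mulr_ge0// ltW.
Qed.

Lemma powR_le1D (R : realType) (d nu : R) :
  0 <= nu <= 1 -> 0 <= d -> d `^ nu <= 1 + d.
Proof.
move=> /andP[nu0 nu1] d0; have [d1|/ltW d1] := leP d 1.
  apply: (@le_trans _ _ (1 `^ nu)); first by apply: ge0_ler_powR; rewrite ?nnegrE.
  by rewrite powR1 lerDl.
by apply: le_trans (ler1_powR d1 nu1) _; rewrite lerDr.
Qed.

(** * Gradients relative to a convex set *)

Section Gradient.
Context {R : realType} {n : nat}.
Implicit Types (X : set 'cV[R]_n) (F : 'cV[R]_n -> R) (g : 'cV[R]_n -> 'cV[R]_n).

Lemma is_gradient_within_line X F x d (s : R) (gs : 'cV[R]_n) :
  is_gradient_within X F (x + s *: d) gs ->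
  forall e, 0 < e -> exists2 r, 0 < r & forall s', `|s' - s| < r ->
    X (x + s' *: d) ->
    `|F (x + s' *: d) - F (x + s *: d) - (s' - s) * dot gs d| <= e * `|s' - s|.
Proof.
move=> Fg e e0.
(* The tolerance is scaled by [enorm d]; the [+ 1] covers the case [d = 0]. *)
have c0 : 0 < e / (enorm d + 1) by rewrite divr_gt0// ltr_wpDl ?enorm_ge0.
have line_cont : (x + s' *: d) @[s' --> s] --> x + s *: d.
  by apply: cvgD; [exact: cvg_cst|apply: cvgZr_tmp; exact: cvg_id].
have /nbhs_ballP[r /= r0 hr] := line_cont _ (Fg _ c0).
exists r => // s' ss' Xs'.
have /hr /= /(_ Xs') : ball s r s' by rewrite /ball /= distrC.
have -> : x + s' *: d - (x + s *: d) = (s' - s) *: d.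
  by rewrite opprD addrACA subrr add0r scalerBl.
rewrite dotZr enormZ => /le_trans; apply.
rewrite mulrCA mulrC ler_wpM2r// -mulrA ger_pMr// mulrC ler_pdivrMr ?mul1r ?lerDl//.
by rewrite ltr_wpDl ?enorm_ge0.
Qed.

(** The one-variable mean value theorem for [phi] on [[0, 1]]. As [x] and [y] may be boundary points
    of [X], [phi] is controlled only on [[0, 1]]: it is differentiated in the interior and is
    continuous relative to the closed interval. *)
Lemma mean_value_segment X F g : convex_set X ->
  (forall x, X x -> is_gradient_within X F x (g x)) ->
  forall x y, X x -> X y -> exists2 s, 0 <= s <= 1 &
    F y - F x = dot (g (x + s *: (y - x))) (y - x).
Proof.
move=> cX Fg x y Xx Xy; set d := y - x.
have Xs s : 0 <= s <= 1 -> X (x + s *: d).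
  by move=> s01; rewrite -convex_combE; apply: convex_setP.
pose phi s := F (x + s *: d); pose dphi s := dot (g (x + s *: d)) d.
have phi_line s : 0 <= s <= 1 -> forall e, 0 < e -> exists2 r, 0 < r &
    forall s', `|s' - s| < r -> 0 <= s' <= 1 ->
    `|phi s' - phi s - (s' - s) * dphi s| <= e * `|s' - s|.
  move=> s01 e e0; have [r r0 hr] := is_gradient_within_line (Fg _ (Xs _ s01)) e0.
  by exists r => // s' ss' s'01; apply/hr/Xs.
have [|||s s01] := @MVT _ phi dphi 0 1.
- by [].
- move=> s; rewrite in_itv /= => /andP[s0 s1].
  suff Dphi : h^-1 *: ((phi \o shift s) (h *: (1 : R)) - phi s) @[h --> 0^'] --> dphi s.
    by apply: DeriveDef; [by apply/cvg_ex; exists (dphi s)|exact/cvg_lim].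
  apply/cvgrPdist_le => e e0.
  have [|r r0 hr] := phi_line s _ e e0; first by rewrite !ltW.
  (* The radius also involves [s] and [1 - s], so that [h + s] stays in [[0, 1]]. *)
  have rm0 : 0 < Num.min r (Num.min s (1 - s)).
    by rewrite !lt_min r0 s0 subr_gt0.
  exists (Num.min r (Num.min s (1 - s))) => // h /=.
  rewrite sub0r normrN !lt_min => /and3P[hr' hs h1s] h0.
  have := hr (h + s); rewrite addrK => /(_ hr').
  have /[swap]/[apply] : 0 <= h + s <= 1 by move: hs h1s; rewrite !ltr_norml; lra.
  rewrite [_%:A]mulr1 -ler_pdivrMr ?normr_gt0// -normf_div => hle.
  rewrite distrC; apply: le_trans hle; rewrite le_eqVlt; apply/orP; left.
  by apply/eqP; congr `|_|; rewrite /= [_ *: _]mulrC; field.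
- apply/subspace_continuousP => s; rewrite /= in_itv /= => s01.
  apply/cvgrPdist_le => e e0.
  have [r r0 hr] := phi_line s s01 1 ltr01.
  have c0 : 0 < 1 + `|dphi s| by rewrite ltr_wpDr.
  (* With tolerance 1, the expansion of [phi] at [s] gives the local Lipschitz constant
     [1 + |dphi s|]. *)
  have rm0 : 0 < Num.min r (e / (1 + `|dphi s|)) by rewrite lt_min r0 divr_gt0.
  exists (Num.min r (e / (1 + `|dphi s|))) => // s' /=.
  rewrite distrC lt_min => /andP[ss' se]; rewrite in_itv /= => /(hr s' ss') hle.
  rewrite distrC; apply: (@le_trans _ _ (`|s' - s| * (1 + `|dphi s|))); last first.
    by rewrite -ler_pdivlMr// ltW.
  rewrite -[phi s' - _](subrK ((s' - s) * dphi s)); apply: le_trans (ler_normD _ _) _.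
  by rewrite normrM mulrDr mulr1 lerD2r -[leRHS]mul1r.
- rewrite {1 2}/phi {1}/d scale0r addr0 scale1r [x + _]addrC subrK subr0 mulr1 => eqF.
  by exists s => //; move: s01; rewrite in_itv /= => /andP[s0 s1]; rewrite !ltW.
Qed.

(** On a short step [s] towards [y], the increment of [F] is at least [s * dot gx (y - x)] up to
    [s * e], and at most [s * (F y - F x)] by convexity. Divide by [s], then let [e] be
    arbitrary. *)
Lemma gradient_le_convex X F x y gx : convex_set X -> convex_function X F ->
  is_gradient_within X F x gx -> X x -> X y -> F x + dot gx (y - x) <= F y.
Proof.
move=> cX cF Fg Xx Xy; apply/ler_addgt0Pr => e e0.
have := @is_gradient_within_line X F x (y - x) 0 gx.
rewrite scale0r addr0 => /(_ Fg _ e0)[r r0 hr].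
pose s := Num.min (r / 2) 1.
have s0 : 0 < s by rewrite lt_min divr_gt0//=.
have s01 : 0 <= s <= 1 by rewrite ltW//= ge_min lexx orbT.
have := hr s; rewrite subr0 (ger0_norm (ltW s0)) -convex_combE.
have sr : s < r by rewrite gt_min ltr_pdivrMr// ltr_pMr// ltr1n.
move=> /(_ sr (convex_setP cX Xx Xy s01)).
rewrite ler_norml => /andP[h _].
rewrite -(ler_pM2l s0).
by have := convex_functionP cF Xx Xy s01; move: h; lra.
Qed.

End Gradient.

(** * Three-point inequality for proximal steps *)

Section ThreePoint.
Context {R : realType} {n : nat}.

Lemma enorm_comb_sqr (s : R) (x y p : 'cV[R]_n) :
  enorm ((1 - s) *: x + s *: y - p) ^+ 2 =
  (1 - s) * enorm (x - p) ^+ 2 + s * enorm (y - p) ^+ 2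
  - s * (1 - s) * enorm (y - x) ^+ 2.
Proof.
by rewrite !enorm_sqr !dotE (dotC y x) (dotC p x) (dotC p y); ring.
Qed.

(** Compare [z] with the point [(1 - s) *: z + s *: u]. By [enorm_comb_sqr] the quadratic
    contributes a surplus [c * s * (1 - s) * D]; dividing by [s] yields the claim up to the error
    [s * (c * D)]. *)
Lemma argmin_prox (X : set 'cV[R]_n) (h : 'cV[R]_n -> R) (g p z u : 'cV[R]_n)
  (c : R) : convex_set X -> convex_function X h -> 0 <= c ->
  is_argmin X (fun v => dot g v + c * enorm (v - p) ^+ 2 + h v) z -> X u ->
  dot g z + c * enorm (z - p) ^+ 2 + h z + c * enorm (u - z) ^+ 2
  <= dot g u + c * enorm (u - p) ^+ 2 + h u.
Proof.
move=> cX ch c0 [Xz minz] Xu; apply/ler_addgt0Pr => e e0.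
set D := enorm (u - z) ^+ 2; have D0 : 0 <= c * D by rewrite mulr_ge0 ?sqr_ge0.
have cD0 : 0 < c * D + e by rewrite ltr_wpDl.
(* This [s] lies in [(0, 1]] and makes the error [s * (c * D)] at most [e]. *)
pose s := e / (c * D + e).
have s0 : 0 < s by rewrite divr_gt0.
have s01 : 0 <= s <= 1 by rewrite ltW//= ler_pdivrMr// mul1r lerDr.
have sD : s * (c * D) <= e.
  by rewrite mulrAC ler_pdivrMr// ler_pM2l// lerDl ltW.
rewrite -(ler_pM2l s0).
have := minz _ (convex_setP cX Xz Xu s01).
have := convex_functionP ch Xz Xu s01.
rewrite enorm_comb_sqr -/D !dotE => hs mins.
have := ler_wpM2l (ltW s0) sD; move: hs mins; lra.
Qed.

End ThreePoint.

(** The increment of [F] is bounded by a slope [dot (g (x + s *: d)) d] at some point of the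
    segment. Cauchy-Schwarz and the Hoelder condition control its deviation from the slope at
    [x]. *)
Lemma gradient_descent_gap (R : realType) (n : nat) (X : set 'cV[R]_n)
    (F : 'cV[R]_n -> R) (g : 'cV[R]_n -> 'cV[R]_n) (H nu : R) :
  convex_set X ->
  (forall x, X x -> is_gradient_within X F x (g x)) \/
    (forall x, X x -> is_subgradient X F x (g x)) ->
  0 < H -> 0 <= nu <= 1 ->
  (forall x y, X x -> X y -> enorm (g y - g x) <= H * enorm (y - x) `^ nu) ->
  forall x y, X x -> X y ->
    F y - F x - dot (g x) (y - x) <= H * (1 + enorm (y - x)) * enorm (y - x).
Proof.
move=> cX Fg H0 nu01 holder x y Xx Xy; set d := y - x.
have [s s01 hs] : exists2 s, 0 <= s <= 1 & F y - F x <= dot (g (x + s *: d)) d.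
  case: Fg => Fg.
    by have [s s01 ->] := mean_value_segment cX Fg Xx Xy; exists s.
  (* For subgradients the point is [y] itself: the subgradient inequality at [y], tested at [x],
     bounds [F y - F x] from above. *)
  exists 1; first by rewrite ler01 lexx.
  have -> : x + 1 *: d = y by rewrite scale1r addrC subrK.
  rewrite /d -(opprB x y) dotNr.
  by have := Fg _ Xy _ Xx; lra.
have Xs : X (x + s *: d) by rewrite -convex_combE; exact: convex_setP.
have d0 : 0 <= enorm d by exact: enorm_ge0.
apply: (@le_trans _ _ (dot (g (x + s *: d) - g x) d)).
  by rewrite dotDl dotNl lerD2r.
apply: le_trans (CauchySchwarz_dot _ _) (ler_wpM2r d0 _).
apply: le_trans (holder _ _ Xx Xs) _; rewrite addrAC subrr add0r enormZ.
have [s0 s1] := andP s01; rewrite (ger0_norm s0) ler_wpM2l ?(ltW H0)//.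
apply: le_trans (powR_le1D nu01 _) _; first by rewrite mulr_ge0.
by rewrite lerD2l ler_piMl.
Qed.

Lemma gnorm_sqr_ge (R : realType) (n : nat) (G : 'M[R]_n) s (u : 'cV[R]_n) :
  0 <= s -> sym_loewner_ge G s -> s * enorm u ^+ 2 <= gnorm G u ^+ 2.
Proof.
move=> s0 [_ /(_ u)]; rewrite mulmxBl dotDl dotNl mul_scalar_mx dotZl subr_ge0.
rewrite -enorm_sqr => Gs; rewrite [gnorm _ _ ^+ 2]sqr_sqrtr//.
by apply: le_trans Gs; rewrite mulr_ge0// sqr_ge0.
Qed.

(** * Stepsizes and invariants of a run *)

Section Trace.
Context {R : realType} {n : nat}.
Variables (P : upfag_input R n) (T : upfag_trace R n).

Lemma LamS k : Lam T k.+1 = Lam T k + lam T k.+1.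
Proof. by rewrite /Lam big_nat_recr. Qed.

Lemma Lam0 : Lam T 0 = 0.
Proof. by rewrite /Lam big_geq. Qed.

Lemma lam_trial_gt0 k t : 0 < lamhat T k -> 0 < gamma1 P -> 0 <= Lam T k.-1 ->
  0 < lam_trial P T k t.
Proof.
move=> l0 g0 L0; rewrite mulr_gt0// ltr_pwDl ?sqrtr_ge0//.
by rewrite mulr_gt0// exprn_gt0.
Qed.

Lemma alpha_trial_bounds k t : 0 <= Lam T k.-1 -> 0 < lam_trial P T k t ->
  0 < alpha_trial P T k t <= 1.
Proof.
move=> L0 l0; have s0 : 0 < Lam T k.-1 + lam_trial P T k t by rewrite ltr_wpDl.
by rewrite divr_gt0//= ler_pdivrMr// mul1r lerDr.
Qed.

(** The stepsize is the positive root of [lambda ^+ 2 = eta * (Lam + lambda)], so [lambda <= c] as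
    soon as [eta <= c ^+ 2 / (Lam + c)]. *)
Lemma exists_lam_trial_le k c : 0 < lamhat T k -> 0 < gamma1 P < 1 ->
  0 <= Lam T k.-1 -> 0 < c -> exists t, lam_trial P T k t <= c.
Proof.
move=> l0 g01 L0 c0; have Lc0 : 0 < Lam T k.-1 + c by rewrite ltr_wpDl.
have [|t ht] := exists_geometric_le (lamhat T k) g01 (_ : 0 < c ^+ 2 / (Lam T k.-1 + c)).
  by rewrite divr_gt0// exprn_gt0.
exists t; rewrite /lam_trial -/(eta_trial P T k t) in ht *.
set eta := eta_trial P T k t in ht *.
have eta0 : 0 <= eta.
  by case/andP: g01 => g0 _; rewrite mulr_ge0 ?exprn_ge0// ltW.
(* Makes [2 * c - eta] nonnegative, so the square root can be bounded by comparing squares. *)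
have etac : eta <= c.
  apply: le_trans ht _; rewrite ler_pdivrMr// expr2 ler_pM2l//.
  by rewrite lerDr.
move: ht; rewrite ler_pdivlMr// => ht.
suff : Num.sqrt (eta ^+ 2 + 4 * eta * Lam T k.-1) <= 2 * c - eta by lra.
rewrite -[leRHS]ger0_norm; last lra.
by rewrite -sqrtr_sqr ler_wsqrtr//; move: ht; lra.
Qed.

Lemma upfag_run_le N k : (k <= N)%N -> upfag_run P T N -> upfag_run P T k.
Proof.
move=> kN [xs0 xag0 run]; split=> // j /andP[j0 jk].
by apply: run; rewrite j0 (leq_trans jk).
Qed.

Lemma upfag_step3_le k : upfag_step3 P T k ->
  [/\ Psi P (xag T k) <= Psi P (xag T k.-1),
      Psi P (xag T k) <= Psi P (xbar T k) &
      Psi P (xag T k) <= Psi P (xtilde P T k)].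
Proof. by move=> [_ ->]; rewrite !ge_min !lexx !orbT. Qed.

Context (convexX : convex_set (dom P)) (convex_chi : convex_function (dom P) (chi P)).
Context (x0X : dom P (xinit P)) (gamma1_01 : 0 < gamma1 P < 1).

(** The three facts go through one induction: [0 <= Lam] puts the weight [alpha] in [(0, 1]], and
    this keeps [xtilde] in the convex domain. *)
Lemma upfag_run_dom N : upfag_run P T N ->
  [/\ dom P (xs T N), dom P (xag T N) & 0 <= Lam T N].
Proof.
elim: N => [[-> -> _]|N IHN run]; first by rewrite Lam0.
have [/= Xxs Xxag L0] := IHN (upfag_run_le (leqnSn N) run).
case: run => _ _ /(_ N.+1); rewrite /= ltnSn => -[//|].
move=> [[l0 min1] first1 lamE xsE] [[b0 _ min2] first2] [xagE _].
have g0 : 0 < gamma1 P by case/andP: gamma1_01.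
have lt0 : 0 < lam_trial P T N.+1 (tau1 T N.+1) by exact: lam_trial_gt0.
(* An accepted trial solves its subproblem because all earlier trials were rejected. *)
have [Xt1 _] := min1 _ first1.2; have [Xt2 _] := min2 _ first2.2.
split; first by rewrite xsE.
  case: xagE => -> //; apply: convex_setP => //.
  by have /andP[a0 ->] := @alpha_trial_bounds N.+1 _ L0 lt0; rewrite ltW.
by rewrite LamS addr_ge0// lamE ltW.
Qed.

Lemma upfag_run_lam_gt0 N k : upfag_run P T N -> (0 < k <= N)%N -> 0 < lam T k.
Proof.
case: k => // k run kN; have [_ _ L0] := upfag_run_dom (upfag_run_le (ltnW kN) run).
have [_ _ /(_ _ kN) [[[l0 _] _ -> _] _ _]] := run.
by case/andP: gamma1_01 => g0 _; exact: lam_trial_gt0.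
Qed.

(** * Finite termination of both line searches *)

Section Descent.
Context {H : R} (H_gt0 : 0 < H).
Context (descent : forall x y, dom P x -> dom P y ->
  fobj P y - fobj P x - dot (fgrad P x) (y - x) <=
    H * (1 + enorm (y - x)) * enorm (y - x)).

(** If every trial were rejected, every subproblem would be solved, including one with
    [lam_trial <= (2 * C)^-1]. There [C * d ^+ 2] is at most the proximal term, and the slack
    [delta] covers the rest, so that trial is accepted. *)
Lemma linesearch1_finite k : 0 < delta P -> upfag_run P T k.-1 ->
  trials1 P T k -> exists t, linesearch1 P T k t.
Proof.
move=> delta_gt0 run [l0 min1]; have [Xxs Xxag L0] := upfag_run_dom run.
apply: contrapT => /forallNP noA.
have [C C0 hC] := linear_le_quadratic H_gt0 delta_gt0.
have [|t lam_le] := exists_lam_trial_le l0 gamma1_01 L0 (_ : 0 < (2 * C)^-1).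
  by rewrite invr_gt0 mulr_gt0.
have [Xt _] := min1 t (fun s _ => noA s); apply: (noA t).
have lt0 : 0 < lam_trial P T k t.
  by case/andP: gamma1_01 => g0 _; exact: lam_trial_gt0.
rewrite /linesearch1; have := alpha_trial_bounds L0 lt0.
set a := alpha_trial P T k t; set L := lam_trial P T k t in lam_le lt0 *.
move=> /andP[a0 a1]; have a01 : 0 <= a <= 1 by rewrite ltW.
have Xmd : dom P (xmd_trial P T k t) by exact: convex_setP.
have Xtl : dom P (xtilde_trial P T k t) by exact: convex_setP.
have := descent Xmd Xtl.
have -> : xtilde_trial P T k t - xmd_trial P T k t = a *: (trial1 T k t - xs T k.-1).
  by rewrite opprD addrACA subrr add0r -scalerBr.
rewrite dotZr enormZ (gtr0_norm a0).
set d := enorm _; set D := dot _ _ => hd.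
have d0 : 0 <= d by exact: enorm_ge0.
have had : 1 + a * d <= 1 + d by rewrite lerD2l ler_piMl.
(* As [a <= 1], a full factor [a] comes out, matching the slack [delta * a]. *)
have hdd : H * (1 + a * d) * (a * d) <= a * (H * (1 + d) * d).
  rewrite -subr_ge0 [leRHS](_ : _ = a * d * H * (d - a * d)); last ring.
  apply: mulr_ge0; last by move: had; lra.
  by apply: mulr_ge0; [apply: mulr_ge0; [exact: ltW|]|exact: ltW].
have CL : C <= (2 * L)^-1.
  have L20 : 0 < 2 * L by exact: mulr_gt0.
  rewrite -[C]invrK lef_pV2 ?posrE ?invr_gt0//.
  by rewrite -ler_pdivlMl// -invfM.
have := ler_wpM2l (ltW a0) (le_trans (hC d d0) (lerD (ler_wpM2r (sqr_ge0 d) CL) (lexx _))).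
by move: hd hdd; rewrite -[a / _ * _]mulrA; lra.
Qed.

(** Again by contradiction. Testing minimality at the prox centre gives a decrease of at least
    [sigma / (2 * b) * d ^+ 2]. The share [gamma] of it is demanded by the line search; the share
    [sigma - gamma] absorbs [C * d ^+ 2] for small [b]. *)
Lemma linesearch2_finite k : 0 < gamma P -> gamma P < sigma P ->
  0 < gamma2 P < 1 -> (0 < k)%N -> upfag_run P T k.-1 ->
  trials2 P T k -> exists t, linesearch2 P T k t.
Proof.
move=> gamma_gt0 gamma_sigma g201 k0 run [b0 Gs min2].
have [_ Xxag _] := upfag_run_dom run.
apply: contrapT => /forallNP noA.
have ki0 : 0 < k%:R^-1 :> R by rewrite invr_gt0 ltr0n.
have [C C0 hC] := linear_le_quadratic H_gt0 ki0.
have sg0 : 0 < sigma P - gamma P by rewrite subr_gt0.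
have [|t b_le] := exists_geometric_le (betahat T k) g201
    (_ : 0 < (sigma P - gamma P) / (2 * C)).
  by rewrite divr_gt0// mulr_gt0.
have b0' : 0 < beta_trial P T k t.
  by case/andP: g201 => g0 _; rewrite mulr_gt0// exprn_gt0.
have [Xt mint] := min2 t (fun s _ => noA s).
have := mint _ Xxag; rewrite /subproblem2 subrr {2}/gnorm mulmx0.
have -> : dot (0 : 'cV[R]_n) 0 = 0 by rewrite /dot big1// => i _; rewrite mxE mul0r.
rewrite sqrtr0 expr0n mulr0 addr0 => hmin.
apply: (noA t); rewrite /linesearch2 /Psi.
have := gnorm_sqr_ge (trial2 T k t - xag T k.-1) (ltW (lt_trans gamma_gt0 gamma_sigma)) Gs.
have := descent Xxag Xt.
rewrite -/(beta_trial P T k t) in b_le.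
move: hmin; set b := beta_trial P T k t in b0' b_le *.
have b20 : 0 < 2 * b by exact: mulr_gt0.
have c0 : 0 < (2 * b)^-1 by rewrite invr_gt0.
have hCb : C <= (sigma P - gamma P) * (2 * b)^-1.
  rewrite ler_pdivlMr// [leLHS](_ : _ = b * (2 * C)); last ring.
  by rewrite -ler_pdivlMr// mulr_gt0.
rewrite !dotE; set d := enorm _ => hmin hdesc hG.
have d0 : 0 <= d by exact: enorm_ge0.
have := ler_wpM2l (ltW c0) hG; have := ler_wpM2r (sqr_ge0 d) hCb.
by move: hmin hdesc (hC d d0); lra.
Qed.

End Descent.

(** * Monotonicity and the projected gradient bound *)

Lemma upfag_run_Psi_le N m : upfag_run P T N -> (m <= N)%N ->
  Psi P (xag T N) <= Psi P (xag T m).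
Proof.
elim: N => [|N IHN] run; first by rewrite leqn0 => /eqP ->.
rewrite leq_eqVlt => /predU1P[-> //|mN].
have [_ _ /(_ N.+1) [|_ _ /upfag_step3_le[le_step _ _]]] := run; first exact: leqnn.
exact/(le_trans le_step)/(IHN (upfag_run_le (leqnSn N) run)).
Qed.

Lemma upfag_run_beta_gt0 N k : 0 < gamma2 P -> upfag_run P T N ->
  (0 < k <= N)%N -> 0 < beta P T k.
Proof.
move=> g0 [_ _ run] /run[_ [[b0 _ _] _] _].
by rewrite mulr_gt0// exprn_gt0.
Qed.

(** Telescopes the Step 2 decrease, using that [xag k] is no worse than [xbar k] and that the
    displacement has norm [beta k * enorm (ghat k)]. *)
Lemma sum_ghat_le N m : 0 < gamma2 P -> upfag_run P T N -> (m <= N)%N ->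
  \sum_(m.+1 <= k < N.+1) gamma P / 2 * beta P T k * enorm (ghat P T k) ^+ 2
  <= Psi P (xag T m) - Psi P (xag T N) + \sum_(m.+1 <= k < N.+1) k%:R^-1.
Proof.
move=> g0 + mN; rewrite -(subnKC mN); elim: (N - m)%N => [|j IHj] run.
  by rewrite addn0 !big_geq// subrr addr0.
move: run; rewrite addnS => run.
rewrite !(big_nat_recr (m + j).+1) ?ltnS ?leq_addr//=.
have {IHj} := IHj (upfag_run_le (leqnSn _) run).
have b0 : 0 < beta P T (m + j).+1 by apply: (upfag_run_beta_gt0 g0 run); rewrite /= leqnn.
have [_ _ /(_ (m + j).+1) [|_ [_ [+ _]] /upfag_step3_le[_ + _]]] := run.
  exact: leqnn.
rewrite /linesearch2 -/(xbar T _) -/(beta P T _) enormB.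
set b := beta P T _ in b0 *; set d := xag T _ - xbar T _.
rewrite [ghat P T _](_ : _ = b^-1 *: d)// enormZ exprMn real_normK ?num_real//.
set k1 := _%:R^-1.
have -> : gamma P / 2 * b * (b^-1 ^+ 2 * enorm d ^+ 2) =
  gamma P / (2 * b) * enorm d ^+ 2.
  by field; apply: lt0r_neq0.
rewrite /=; lra.
Qed.

(** Apply [sum_ghat_le] from [m = N./2], bound [Psi] there by its value at the start, and pull the
    minimum out of the sum. The default of the [\big] minimum is its own term at [k = 1]. *)
Lemma min_ghat_le N : 0 < gamma P -> 0 < gamma2 P ->
  has_lbound (Psi P @` dom P) -> (1 <= N)%N -> upfag_run P T N ->
  \big[Num.min/enorm (ghat P T 1) ^+ 2]_(1 <= k < N.+1) enorm (ghat P T k) ^+ 2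
  <= 2 * (Psi P (xinit P) - inf (Psi P @` dom P)
          + \sum_(N./2.+1 <= k < N.+1) k%:R^-1)
     / (gamma P * \sum_(N./2.+1 <= k < N.+1) beta P T k).
Proof.
move=> gamma_gt0 g0 lb N0 run; set M := \big[_/_]_(_ <= _ < _) _.
(* Strictness makes the range of summation nonempty, hence the sum of the [beta] positive. *)
have halfN : (N./2 < N)%N by rewrite ltn_half_double -addnn -[ltnLHS]addn0 ltn_add2l.
have in_run k : (N./2.+1 <= k < N.+1)%N -> (0 < k <= N)%N.
  by move=> /andP[mk kN]; rewrite (leq_trans _ mk).
have Mle k : (0 < k <= N)%N -> M <= enorm (ghat P T k) ^+ 2.
  by move=> kN; apply: ge_bigmin_seq => //; rewrite mem_index_iota.
have sum_gt0 : 0 < \sum_(N./2.+1 <= k < N.+1) beta P T k.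
  rewrite big_nat_recr//= ltr_wpDl//.
    rewrite big_nat_cond sumr_ge0// => k; rewrite andbT => /andP[mk kN].
    by apply/ltW/(upfag_run_beta_gt0 g0 run)/in_run; rewrite mk ltnW.
  by apply: (upfag_run_beta_gt0 g0 run); rewrite N0 leqnn.
rewrite ler_pdivlMr ?mulr_gt0//.
have inf_le : inf (Psi P @` dom P) <= Psi P (xag T N).
  by apply: ge_inf => //; have [_ Xxag _] := upfag_run_dom run; exists (xag T N).
have x0_ge : Psi P (xag T N./2) <= Psi P (xinit P).
  have [_ <- _] := run.
  exact: (upfag_run_Psi_le (upfag_run_le (ltnW halfN) run)).
have := sum_ghat_le g0 run (ltnW halfN).
suff : M * (gamma P / 2 * \sum_(N./2.+1 <= k < N.+1) beta P T k) <=
  \sum_(N./2.+1 <= k < N.+1) gamma P / 2 * beta P T k * enorm (ghat P T k) ^+ 2.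
  by move: inf_le x0_ge; lra.
rewrite !mulr_sumr !big_nat; apply: ler_sum => k /in_run kN.
rewrite mulrC ler_pM2l ?Mle// mulr_gt0// ?divr_gt0//.
exact: upfag_run_beta_gt0 run kN.
Qed.

(** * Accelerated rate for convex objectives *)

Lemma alphaM_Lam N k : upfag_run P T N -> (k < N)%N ->
  (1 - alpha T k.+1) * Lam T k.+1 = Lam T k.
Proof.
move=> run kN; have [_ _ L0] := upfag_run_dom (upfag_run_le (ltnW kN) run).
have l0 : 0 < lam T k.+1 by exact: upfag_run_lam_gt0 run _.
by rewrite /alpha LamS; field; apply: lt0r_neq0; rewrite ltr_wpDl.
Qed.

(** By [alphaM_Lam] the factor [1 - alpha] turns [Lam] back into its predecessor, so the product
    does not depend on [N]. *)
Lemma Gam_Lam N : upfag_run P T N.+1 -> Gam T N.+1 * Lam T N.+1 = lam T 1.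
Proof.
elim: N => [|N IHN] run; first by rewrite LamS Lam0 add0r mul1r.
rewrite [Gam T _]/(_ * Gam T N.+1) mulrAC (alphaM_Lam run) ?ltnSn// mulrC.
exact/IHN/upfag_run_le/run.
Qed.

Section Convex.
Context (fgrad_le : forall x y, dom P x -> dom P y ->
  fobj P x + dot (fgrad P x) (y - x) <= fobj P y).

(** Lower linearizations at [xmd], weighted [1 - a] at the old [xag] and [a] at [u], are combined
    with the line search, the three-point inequality and convexity of [chi]; the result is scaled by
    [Lam]. *)
Lemma potential_step N u : dom P u -> upfag_run P T N.+1 ->
  Lam T N.+1 * (Psi P (xag T N.+1) - Psi P u) + enorm (u - xs T N.+1) ^+ 2 / 2
  <= Lam T N * (Psi P (xag T N) - Psi P u) + enorm (u - xs T N) ^+ 2 / 2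
     + delta P * lam T N.+1.
Proof.
move=> Xu run; have [Xxs Xxag L0] := upfag_run_dom (upfag_run_le (leqnSn N) run).
have l0 : 0 < lam T N.+1 by apply: (upfag_run_lam_gt0 run); rewrite /= leqnn.
have [Xxs' _ _] := upfag_run_dom run.
have [_ _ /(_ N.+1) [|]] := run; first exact: leqnn.
move=> [[_ min1] [ls1 first1] lamE xsE] _ /upfag_step3_le[_ _ xag_le].
have := min1 _ first1; move: ls1 xag_le; rewrite /linesearch1 /subproblem1 /xtilde.
rewrite -lamE -xsE /=.
have LN : 0 < Lam T N.+1 by rewrite LamS ltr_wpDl.
have aE : alpha_trial P T N.+1 (tau1 T N.+1) = lam T N.+1 / Lam T N.+1.
  by rewrite /alpha_trial -lamE LamS.
have a01 : 0 <= alpha_trial P T N.+1 (tau1 T N.+1) <= 1.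
  by rewrite aE divr_ge0 ?(ltW l0) ?(ltW LN)//= ler_pdivrMr// mul1r LamS lerDr.
have Xmd : dom P (xmd_trial P T N.+1 (tau1 T N.+1)) by exact: convex_setP.
have := convex_functionP convex_chi Xxag Xxs' a01.
rewrite /xtilde_trial -xsE /=.
have := fgrad_le Xmd Xxag; have := fgrad_le Xmd Xu.
rewrite !dotE /=.
set md := xmd_trial _ _ _ _; set g := fgrad P md; set a := alpha_trial _ _ _ _ in aE a01 *.
set L := lam T N.+1 in l0 aE *; set W := Lam T N.+1 in LN aE *.
move=> fu fxag chi_le fxt xag_le argmin1.
have c0 : 0 <= (2 * L)^-1 by rewrite invr_ge0 mulr_ge0// ltW.
have prox := argmin_prox convexX convex_chi c0 argmin1 Xu.
have [a0 a1] := andP a01.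
have step : Psi P (xag T N.+1) <= (1 - a) * Psi P (xag T N) + a * Psi P u
  + a * (2 * L)^-1 * (enorm (u - xs T N) ^+ 2 - enorm (u - xs T N.+1) ^+ 2)
  + delta P * a.
  have a1' : 0 <= 1 - a by rewrite subr_ge0.
  move: (ler_wpM2l a1' fxag) (ler_wpM2l a0 fu) (ler_wpM2l a0 prox).
  by move: xag_le fxt chi_le; rewrite /Psi; lra.
have -> : Lam T N = (1 - a) * W.
  by rewrite aE mulrBl mul1r mulfVK ?lt0r_neq0// /W LamS addrK.
have Wa : W * a = L by rewrite aE mulrC mulfVK// lt0r_neq0.
(* After scaling, the squared distances carry the constant weight 1/2, which lets them telescope. *)
have Wac : W * (a * (2 * L)^-1) = 2^-1.
  by rewrite mulrA Wa; field; exact: lt0r_neq0.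
move: (ler_wpM2l (ltW LN) step).
have -> : W * ((1 - a) * Psi P (xag T N) + a * Psi P u
  + a * (2 * L)^-1 * (enorm (u - xs T N) ^+ 2 - enorm (u - xs T N.+1) ^+ 2)
  + delta P * a) = W * ((1 - a) * Psi P (xag T N) + a * Psi P u + delta P * a)
  + (enorm (u - xs T N) ^+ 2 - enorm (u - xs T N.+1) ^+ 2) / 2.
  by rewrite [X in _ = _ + X]mulrC -Wac; ring.
rewrite -Wa; lra.
Qed.

Lemma potential_le N u : dom P u -> upfag_run P T N ->
  Lam T N * (Psi P (xag T N) - Psi P u) + enorm (u - xs T N) ^+ 2 / 2
  <= enorm (u - xinit P) ^+ 2 / 2 + delta P * Lam T N.
Proof.
move=> Xu; elim: N => [[-> -> _]|N IHN run].
  by rewrite Lam0 mul0r mulr0 add0r addr0.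
have := potential_step Xu run; have := IHN (upfag_run_le (leqnSn N) run).
have : delta P * Lam T N.+1 = delta P * Lam T N + delta P * lam T N.+1.
  by rewrite LamS mulrDr.
lra.
Qed.

(** Divide [potential_le] by [Lam N], discarding the final squared distance; [Gam_Lam] rewrites
    [1 / Lam N] as [Gam N / lam 1]. *)
Lemma Psi_gap_le N u : dom P u -> (1 <= N)%N -> upfag_run P T N ->
  Psi P (xag T N) - Psi P u
  <= Gam T N * enorm (xinit P - u) ^+ 2 / (2 * lam T 1) + delta P.
Proof.
case: N => // N Xu _ run; have pot := potential_le Xu run.
have [_ _ L0] := upfag_run_dom (upfag_run_le (leqnSn N) run).
have l0 : 0 < lam T N.+1 by apply: (upfag_run_lam_gt0 run); rewrite /= leqnn.
have LN : 0 < Lam T N.+1 by rewrite LamS ltr_wpDl.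
have l1 : 0 < lam T 1 by exact: upfag_run_lam_gt0 run _.
rewrite -(Gam_Lam run) in l1 *; rewrite [enorm (xinit P - u)]enormB.
have G0 : 0 < Gam T N.+1 by rewrite -(pmulr_lgt0 _ LN).
have -> : Gam T N.+1 * enorm (u - xinit P) ^+ 2 / (2 * (Gam T N.+1 * Lam T N.+1))
  = (enorm (u - xinit P) ^+ 2 / 2) / Lam T N.+1.
  by field; rewrite !lt0r_neq0.
rewrite -lerBlDr ler_pdivlMr//.
by have := sqr_ge0 (enorm (u - xs T N.+1)); move: pot; lra.
Qed.

End Convex.
End Trace.

Theorem theorem4 (R : realType) (n : nat) (P : upfag_input R n) (H nu : R)
  (closedX : closed (dom P)) (convexX : convex_set (dom P))
  (convex_chi : convex_function (dom P) (chi P))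
  (f'P : (forall x, dom P x -> is_gradient_within (dom P) (fobj P) x (fgrad P x))
    \/ [/\ nu = 0, convex_function (dom P) (fobj P) &
          forall x, dom P x -> is_subgradient (dom P) (fobj P) x (fgrad P x)])
  (H_gt0 : 0 < H) (nu_01 : 0 <= nu <= 1)
  (holder : forall x y, dom P x -> dom P y ->
     enorm (fgrad P y - fgrad P x) <= H * enorm (y - x) `^ nu)
  (x0X : dom P (xinit P))
  (gamma_gt0 : 0 < gamma P) (gamma_sigma : gamma P < sigma P)
  (sigma_lt1 : sigma P < 1)
  (gamma1_01 : 0 < gamma1 P < 1) (gamma2_01 : 0 < gamma2 P < 1)
  (delta_gt0 : 0 < delta P)
  (T : upfag_trace R n) :
  (* (a) *)
  (forall k, (1 <= k)%N -> upfag_run P T k.-1 ->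
     (trials1 P T k -> exists t, is_first (linesearch1 P T k) t) /\
     (trials2 P T k -> exists t, is_first (linesearch2 P T k) t))
  /\
  (* (b) *)
  (has_lbound (Psi P @` dom P) ->
   forall N, (1 <= N)%N -> upfag_run P T N ->
     \big[Num.min/enorm (ghat P T 1) ^+ 2]_(1 <= k < N.+1) enorm (ghat P T k) ^+ 2
     <= 2 * (Psi P (xinit P) - inf (Psi P @` dom P)
             + \sum_(N./2.+1 <= k < N.+1) k%:R^-1)
        / (gamma P * \sum_(N./2.+1 <= k < N.+1) beta P T k))
  /\
  (* (c) *)
  (convex_function (dom P) (fobj P) ->
   forall xstar, is_argmin (dom P) (Psi P) xstar ->
   forall N, (1 <= N)%N -> upfag_run P T N ->
     Psi P (xag T N) - Psi P xstar
     <= Gam T N * enorm (xinit P - xstar) ^+ 2 / (2 * lam T 1) + delta P).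
Proof.
have gradP : (forall x, dom P x -> is_gradient_within (dom P) (fobj P) x (fgrad P x))
    \/ (forall x, dom P x -> is_subgradient (dom P) (fobj P) x (fgrad P x)).
  by case: f'P => [|[]]; [left|right].
have descent := gradient_descent_gap convexX gradP H_gt0 nu_01 holder.
have gamma2_gt0 : 0 < gamma2 P by case/andP: gamma2_01.
split; last split.
- move=> k k0 run; split=> trials; apply: exists_is_first.
    exact: (linesearch1_finite convexX x0X gamma1_01 H_gt0 descent).
  exact: (linesearch2_finite convexX x0X gamma1_01 H_gt0 descent).
- by move=> lb N N0 run; apply: (min_ghat_le convexX x0X gamma1_01).
- move=> convex_f xstar [Xxstar _] N N0 run.
  apply: (Psi_gap_le convexX convex_chi x0X gamma1_01) => // x y Xx Xy.
  (* Either way [fgrad] is a subgradient: by convexity if it is a gradient, by assumption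
     otherwise. *)
  case: gradP => [/(_ _ Xx) Fg|/(_ _ Xx)]; last exact.
  exact: gradient_le_convex Fg Xx Xy.
Qed.
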